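(* Let $\mathcal{M}$ be a Sullivan minimal algebra over a field $\mathbb{K}$ of characteristic $0$, and let $\omega\in\mathcal{M}$ be a closed element satisfying: (1) $|\omega|=2r$ for some odd integer $r$, and $[\omega]$ has a representative of the form $\sum_{i=1}^k x_iy_i$ with all $x_i,y_i$ closed elements of $\mathcal{M}^r$; (2) there exists $s\ge 0$ such that $H^s(\mathcal{M})\neq 0$, the map $H^s(\mathcal{M})\to H^{s+2r}(\mathcal{M})$ given by multiplication by $[\omega]$ is an isomorphism, and the map $H^{s-r}(\mathcal{M})\to H^{s+r}(\mathcal{M})$ given by multiplication by $[\omega]$ is injective. Then $\mathcal{M}_\theta=\mathcal{M}\otimes\Lambda\theta$, with $|\theta|=2r-1$ and $d\theta=\omega$, is non-formal.
   Context: A Sullivan minimal algebra is a CDGA $\mathcal{M}=\Lambda V^*$, free as a graded commutative algebra, where $V^*$ has a homogeneous basis $\{v_\alpha\}$ indexed by a well-ordered set such that (1) $dv_\alpha$ lies in the subalgebra generated by the $v_\beta$ with $\beta<\alpha$, and (2) if $|v_\beta|<|v_\alpha|$ then $\beta<\alpha$. A CDGA is formal if it is connected to its cohomology (with zero differential) by a zigzag of quasi-isomorphisms. *)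

(* Defs.v *)
From mathcomp Require Import all_boot all_order all_algebra.
Set Implicit Arguments. Unset Strict Implicit. Unset Printing Implicit Defensive.
Import Order.TTheory GRing.Theory Num.Theory.
Local Open Scope ring_scope.

Record cdga (K : fieldType) := CDGA {
  cd_alg : algType K;
  cd_hom : nat -> cd_alg -> Prop;
  cd_d   : cd_alg -> cd_alg;
  cd_hom_sub : forall n, cd_hom n 0 /\
      (forall (a : K) x y, cd_hom n x -> cd_hom n y -> cd_hom n (a *: x + y));
  cd_hom_span : forall x : cd_alg, exists (N : nat) (c : nat -> cd_alg),
      (forall n, cd_hom n (c n)) /\ x = \sum_(n < N) c n;
  cd_hom_indep : forall (N : nat) (c : nat -> cd_alg),
      (forall n, cd_hom n (c n)) -> \sum_(n < N) c n = 0 ->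
      forall n, (n < N)%N -> c n = 0;
  cd_hom1 : cd_hom 0 1;
  cd_homM : forall p q x y, cd_hom p x -> cd_hom q y -> cd_hom (p + q) (x * y);
  cd_gcomm : forall p q x y, cd_hom p x -> cd_hom q y ->
      x * y = (-1) ^+ (p * q) *: (y * x);
  cd_d_lin : forall (a : K) x y, cd_d (a *: x + y) = a *: cd_d x + cd_d y;
  cd_d_hom : forall n x, cd_hom n x -> cd_hom n.+1 (cd_d x);
  cd_dd : forall x, cd_d (cd_d x) = 0;
  cd_leibniz : forall p x y, cd_hom p x ->
      cd_d (x * y) = cd_d x * y + (-1) ^+ p *: (x * cd_d y)
}.

Arguments cd_hom {K} _ _ _.
Arguments cd_d {K} _ _.

Section CDGATheory.
Variable K : fieldType.

Definition cocycle (A : cdga K) (n : nat) (x : cd_alg A) : Prop :=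
  cd_hom A n x /\ cd_d A x = 0.

Definition exact (A : cdga K) (x : cd_alg A) : Prop :=
  exists y, x = cd_d A y.

Definition graded_alg_morphism (A B : cdga K) (f : cd_alg A -> cd_alg B)
  : Prop :=
  [/\ forall (a : K) x y, f (a *: x + y) = a *: f x + f y,
      forall x y, f (x * y) = f x * f y,
      f 1 = 1 &
      forall n x, cd_hom A n x -> cd_hom B n (f x)].

Definition cdga_morphism (A B : cdga K) (f : cd_alg A -> cd_alg B) : Prop :=
  graded_alg_morphism f /\ forall x, f (cd_d A x) = cd_d B (f x).

Definition quasi_iso (A B : cdga K) (f : cd_alg A -> cd_alg B) : Prop :=
  [/\ cdga_morphism f,
      (forall n b, cocycle n b -> exists a, cocycle n a /\ exact (f a - b)) &
      (forall n a, cocycle n a -> exact (f a) -> exact a)].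

Inductive zigzag : cdga K -> cdga K -> Prop :=
  | zz_refl A : zigzag A A
  | zz_fwd (A B C : cdga K) (f : cd_alg A -> cd_alg B) :
      quasi_iso f -> zigzag B C -> zigzag A C
  | zz_bwd (A B C : cdga K) (f : cd_alg B -> cd_alg A) :
      quasi_iso f -> zigzag B C -> zigzag A C.

(* A is formal: connected by a zigzag of quasi-isomorphisms to a CDGA with
   zero differential (which is then necessarily isomorphic to H(A) with
   zero differential). *)
Definition formal (A : cdga K) : Prop :=
  exists C : cdga K, (forall x, cd_d C x = 0) /\ zigzag A C.

Definition in_gen_subalg (A : cdga K) (S : cd_alg A -> Prop) (x : cd_alg A)
  : Prop :=
  forall T : cd_alg A -> Prop,
    (forall y, S y -> T y) -> T 1 ->
    (forall (a : K) y z, T y -> T z -> T (a *: y + z)) ->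
    (forall y z, T y -> T z -> T (y * z)) ->
    T x.

(* A is the free graded commutative algebra on the homogeneous family
   (v i), deg (v i) = deg i: universal property among graded commutative
   algebras (every graded commutative algebra is a CDGA with d = 0, so we
   may quantify over CDGAs and ignore their differential). *)
Definition free_gc_on (A : cdga K) (I : Type) (v : I -> cd_alg A)
  (deg : I -> nat) : Prop :=
  (forall i, cd_hom A (deg i) (v i)) /\
  forall (B : cdga K) (g : I -> cd_alg B),
    (forall i, cd_hom B (deg i) (g i)) ->
    exists phi : cd_alg A -> cd_alg B,
      [/\ graded_alg_morphism phi, (forall i, phi (v i) = g i) &
          forall psi : cd_alg A -> cd_alg B,
            graded_alg_morphism psi -> (forall i, psi (v i) = g i) ->
            forall x, psi x = phi x].

Definition strict_well_order (I : Type) (lt : I -> I -> Prop) : Prop :=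
  [/\ well_founded lt,
      (forall i, ~ lt i i),
      (forall i j k, lt i j -> lt j k -> lt i k) &
      (forall i j, lt i j \/ i = j \/ lt j i)].

Definition sullivan_minimal (M : cdga K) : Prop :=
  exists (I : Type) (lt : I -> I -> Prop) (v : I -> cd_alg M)
         (deg : I -> nat),
    [/\ strict_well_order lt,
        (forall i, (0 < deg i)%N),
        free_gc_on v deg,
        (forall a, in_gen_subalg (fun y => exists b, lt b a /\ y = v b)
                                 (cd_d M (v a))) &
        (forall a b, (deg b < deg a)%N -> lt b a)].

(* N is M (x) Lambda theta with |theta| = m and d theta = omega:
   i : M -> N is a CDGA morphism, theta has degree m, d theta = i omega,
   and every element of N is uniquely i a + i b * theta (a, b in M). *)
Definition is_KS_extension (M N : cdga K) (omega : cd_alg M) (m : nat)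
  (i : cd_alg M -> cd_alg N) (theta : cd_alg N) : Prop :=
  [/\ cdga_morphism i,
      cd_hom N m theta,
      cd_d N theta = i omega &
      bijective (fun ab : cd_alg M * cd_alg M => i ab.1 + i ab.2 * theta)].

End CDGATheory.

(* Main.v *)
(* Write r = t + 1. The property that 0 lies in every defined product
   <u, v, v> with |v| odd passes along quasi-isomorphisms in both directions and holds when
   d = 0, hence holds in a formal algebra. For a in H^s(M) and w, v in H^r(M) write
   a w v = omega b. In the extension a w v becomes exact, and the products
   <a w, v, v> contain +-(b theta) v plus terms coming from M, up to an
   indeterminacy which injectivity of omega on H^s confines to M. Formality thus
   forces b v = 0. Polarising, the operators A_(w,v) : a |-> b on H^s are such that
   A_(w,v)(a) v' is antisymmetric in w, v, v', so that they commute and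
   A_(w,v)^2 = 0. But the sum of the A_(x_j,y_j) is the identity, so H^s = 0. *)
Require Import Defs.
From mathcomp Require Import all_boot all_order all_algebra.
From mathcomp Require Import zify.
Import Order.TTheory GRing.Theory Num.Theory.
Set Implicit Arguments. Unset Strict Implicit. Unset Printing Implicit Defensive.
Local Open Scope ring_scope.

(** * Homogeneous components, cocycles and exactness in a CDGA *)

Section Cdga.
Context {K : fieldType} {A : cdga K}.
Implicit Types x y z : cd_alg A.
Local Notation d := (cd_d A).
Local Notation hom := (cd_hom A).

Lemma cd_dD x y : d (x + y) = d x + d y.
Proof. by rewrite -[x]scale1r cd_d_lin !scale1r. Qed.

Lemma cd_d0 : d 0 = 0.
Proof. by apply: (addrI (d 0)); rewrite -cd_dD !addr0. Qed.

Lemma cd_dZ a x : d (a *: x) = a *: d x.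
Proof. by rewrite -[a *: x]addr0 cd_d_lin cd_d0 addr0. Qed.

Lemma cd_dN x : d (- x) = - d x.
Proof. by rewrite -scaleN1r cd_dZ scaleN1r. Qed.

Lemma cd_dB x y : d (x - y) = d x - d y.
Proof. by rewrite cd_dD cd_dN. Qed.

Lemma cd_d_sum n (c : nat -> cd_alg A) :
  d (\sum_(j < n) c j) = \sum_(j < n) d (c j).
Proof. exact: (big_morph d cd_dD cd_d0). Qed.

Lemma cd_hom0 n : hom n 0.
Proof. by have [] := cd_hom_sub A n. Qed.

Lemma cd_homZ n a x : hom n x -> hom n (a *: x).
Proof.
by move=> hx; rewrite -[a *: x]addr0; apply: (cd_hom_sub A n).2 => //; apply: cd_hom0.
Qed.

Lemma cd_homD n x y : hom n x -> hom n y -> hom n (x + y).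
Proof. by move=> hx hy; rewrite -[x]scale1r; apply: (cd_hom_sub A n).2. Qed.

Lemma cd_homN n x : hom n x -> hom n (- x).
Proof. by rewrite -scaleN1r; apply: cd_homZ. Qed.

Lemma cd_homB n x y : hom n x -> hom n y -> hom n (x - y).
Proof. by move=> hx hy; apply: cd_homD => //; apply: cd_homN. Qed.

Lemma cd_hom_eq {n} m {x} : hom n x -> n = m -> hom m x.
Proof. by move=> hx <-. Qed.

Lemma cd_hom_ind (P : cd_alg A -> Prop) :
    (forall n x, hom n x -> P x) -> (forall x y, P x -> P y -> P (x + y)) ->
  forall x, P x.
Proof.
move=> Phom PD x; have [n [c [hc ->]]] := cd_hom_span x.
by elim/big_ind: _ => [|//|j _]; [apply: (Phom 0%N); apply: cd_hom0 | apply: Phom].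
Qed.

(** Padding by zeros makes every large enough bound valid, so that several decompositions can be
    compared over one range. *)
Lemma cd_hom_components x : exists (n : nat) (c : nat -> cd_alg A),
  (forall j, hom j (c j)) /\ forall m, (n <= m)%N -> x = \sum_(j < m) c j.
Proof.
have [n [c [hc ->]]] := cd_hom_span x.
exists n, (fun j => if (j < n)%N then c j else 0); split.
  by move=> j; case: ifP => // _; apply: cd_hom0.
move=> m le_nm; rewrite (big_ord_widen m c le_nm) big_mkcond.
by apply: eq_bigr.
Qed.

(** Subtracting [x] from [c n] leaves homogeneous terms of sum zero, which vanish by
    independence. *)
Lemma cd_hom_component n x m (c : nat -> cd_alg A) :
  hom n x -> (forall j, hom j (c j)) -> x = \sum_(j < m) c j -> (n < m)%N ->
  x = c n.
Proof.
move=> hx hc def_x lt_nm.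
pose e j := c j - (if j == n then x else 0).
have he j : hom j (e j).
  by apply: cd_homB => //; case: eqP => [->|_] //; apply: cd_hom0.
have se : \sum_(j < m) e j = 0.
  rewrite sumrB -def_x -big_mkcond /=.
  by rewrite (big_pred1 (Ordinal lt_nm)) ?subrr // => j; rewrite -val_eqE.
have /eqP := cd_hom_indep he se lt_nm.
by rewrite /e eqxx subr_eq0 => /eqP.
Qed.

Lemma cd_dMr x y : d y = 0 -> d (x * y) = d x * y.
Proof.
move=> dy; elim/cd_hom_ind: x => [n x hx|x z IHx IHz].
  by rewrite (cd_leibniz y hx) dy mulr0 scaler0 addr0.
by rewrite mulrDl !cd_dD IHx IHz mulrDl.
Qed.

Lemma cd_dMl n x y : cocycle n x -> d (x * y) = (-1) ^+ n *: (x * d y).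
Proof. by move=> [hx dx]; rewrite (cd_leibniz y hx) dx mul0r add0r. Qed.

Lemma cocycle0 n : cocycle n (0 : cd_alg A).
Proof. by split; [apply: cd_hom0 | apply: cd_d0]. Qed.

Lemma cocycleD n x y : cocycle n x -> cocycle n y -> cocycle n (x + y).
Proof. by move=> [hx dx] [hy dy]; split; [apply: cd_homD | rewrite cd_dD dx dy addr0]. Qed.

Lemma cocycleZ n a x : cocycle n x -> cocycle n (a *: x).
Proof. by move=> [hx dx]; split; [apply: cd_homZ | rewrite cd_dZ dx scaler0]. Qed.

Lemma cocycleN n x : cocycle n x -> cocycle n (- x).
Proof. by move=> [hx dx]; split; [apply: cd_homN | rewrite cd_dN dx oppr0]. Qed.

Lemma cocycleM n m x y : cocycle n x -> cocycle m y -> cocycle (n + m) (x * y).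
Proof.
move=> [hx dx] [hy dy]; split; first exact: cd_homM.
by rewrite cd_dMr // dx mul0r.
Qed.

Lemma cocycle_eq {n} m {x} : cocycle n x -> n = m -> cocycle m x.
Proof. by move=> hx <-. Qed.

Lemma exact_d x : exact (d x). Proof. by exists x. Qed.

Lemma exact0 : exact (0 : cd_alg A).
Proof. by exists 0; rewrite cd_d0. Qed.

Lemma exactD x y : exact x -> exact y -> exact (x + y).
Proof. by move=> [a ->] [b ->]; rewrite -cd_dD; apply: exact_d. Qed.

Lemma exactZ a x : exact x -> exact (a *: x).
Proof. by move=> [b ->]; rewrite -cd_dZ; apply: exact_d. Qed.

Lemma exactN x : exact (- x) <-> exact x.
Proof.
by split=> [/(exactZ (-1))|/(exactZ (-1))]; rewrite scaleN1r ?opprK.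
Qed.

Lemma exactB x y : exact x -> exact y -> exact (x - y).
Proof. by move=> ex ey; apply: exactD => //; apply/exactN. Qed.

Lemma exactDr x y : exact y -> exact (x + y) <-> exact x.
Proof.
move=> ey; split=> [exy | ex]; last exact: exactD.
by rewrite -[x](addrK y); apply: exactB.
Qed.

Lemma exactDl x y : exact x -> exact (x + y) <-> exact y.
Proof. by rewrite addrC; apply: exactDr. Qed.

Lemma exact_of_sub x y : exact (x - y) -> exact y -> exact x.
Proof. by move=> exy ey; rewrite -[x](subrK y); apply: exactD. Qed.

Lemma exact_sum (I : finType) (F : I -> cd_alg A) :
  (forall j, exact (F j)) -> exact (\sum_j F j).
Proof. by move=> eF; elim/big_ind: _ => //; [apply: exact0 | apply: exactD]. Qed.

Lemma exactMr x y : d y = 0 -> exact x -> exact (x * y).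
Proof. by move=> dy [a ->]; rewrite -cd_dMr //; apply: exact_d. Qed.

Lemma exactMl n x y : cocycle n x -> exact y -> exact (x * y).
Proof.
move=> cx [a ->]; exists ((-1) ^+ n *: (x * a)).
by rewrite cd_dZ (cd_dMl _ cx) scalerA -expr2 sqrr_sign scale1r.
Qed.

(** As [d] raises degrees by one, the component in degree [n - 1] of any primitive already bounds
    [x]. In degree 0 there is no such component and [x] vanishes. *)
Lemma exact_hom n x : hom n x -> exact x ->
  exists y, x = d y /\ (if n is n'.+1 then hom n' y else y = 0).
Proof.
move=> hx [y def_x]; have [m [c [hc def_y]]] := cd_hom_components y.
pose e j := if j is j'.+1 then d (c j') else 0.
have he j : hom j (e j) by case: j => [|j] /=; [apply: cd_hom0 | apply: cd_d_hom].
have -> : x = e n.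
  apply: (@cd_hom_component n x (m + n).+1 e hx he); last by lia.
  by rewrite def_x (def_y (m + n)%N (leq_addr _ _)) cd_d_sum big_ord_recl add0r.
case: n {hx} => [|n] /=; first by exists 0; rewrite cd_d0.
by exists (c n).
Qed.

Lemma odd_comm p q x y : odd p -> odd q -> hom p x -> hom q y -> x * y = - (y * x).
Proof.
by move=> op oq hx hy; rewrite (cd_gcomm hx hy) -signr_odd oddM op oq expr1 scaleN1r.
Qed.

Lemma even_comm p q x y : ~~ odd p -> hom p x -> hom q y -> x * y = y * x.
Proof.
by move=> /negPf ep hx hy; rewrite (cd_gcomm hx hy) -signr_odd oddM ep expr0 scale1r.
Qed.

Lemma odd_sqr0 p x : (2 : K) != 0 -> odd p -> hom p x -> x * x = 0.
Proof.
move=> nz2 op hx; have /eqP := odd_comm op op hx hx.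
rewrite -addr_eq0 -mulr2n -scaler_nat => /eqP x2.
by rewrite -[x * x]scale1r -(mulVf nz2) -scalerA x2 scaler0.
Qed.

End Cdga.

(** * Morphisms of CDGAs *)

Section Morphism.
Context {K : fieldType} {A B : cdga K} {f : cd_alg A -> cd_alg B}.
Hypothesis mf : cdga_morphism f.

Lemma morD x y : f (x + y) = f x + f y.
Proof. by case: mf => -[fl _ _ _] _; rewrite -[x]scale1r fl !scale1r. Qed.

Lemma mor0 : f 0 = 0.
Proof. by apply: (addrI (f 0)); rewrite -morD !addr0. Qed.

Lemma morZ a x : f (a *: x) = a *: f x.
Proof. by case: mf => -[fl _ _ _] _; rewrite -[a *: x]addr0 fl mor0 addr0. Qed.

Lemma morN x : f (- x) = - f x.
Proof. by rewrite -scaleN1r morZ scaleN1r. Qed.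

Lemma morB x y : f (x - y) = f x - f y.
Proof. by rewrite morD morN. Qed.

Lemma mor_sum n (c : nat -> cd_alg A) :
  f (\sum_(j < n) c j) = \sum_(j < n) f (c j).
Proof. exact: (big_morph f morD mor0). Qed.

Lemma morM x y : f (x * y) = f x * f y.
Proof. by case: mf => -[]. Qed.

Lemma mor_d x : f (cd_d A x) = cd_d B (f x).
Proof. by case: mf. Qed.

Lemma mor_hom n x : cd_hom A n x -> cd_hom B n (f x).
Proof. by case: mf => -[_ _ _ fh] _; apply: fh. Qed.

Lemma mor_cocycle n x : cocycle n x -> cocycle n (f x).
Proof. by move=> [hx dx]; split; [apply: mor_hom | rewrite -mor_d dx mor0]. Qed.

Lemma mor_exact x : exact x -> exact (f x).
Proof. by move=> [y ->]; rewrite mor_d; apply: exact_d. Qed.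

End Morphism.

(* 0 is in <u, v, v>: xi bounds u v, and zeta is an arbitrary bounding cochain
   of v v = 0, that is, a cocycle. *)
Definition massey_uvv_vanish (K : fieldType) (A : cdga K) : Prop :=
  forall p m u v, cocycle p u -> cocycle m.+1 v -> ~~ odd m -> exact (u * v) ->
  exists xi zeta : cd_alg A,
    [/\ cd_hom A (p + m) xi, cd_d A xi = u * v, cocycle (m + m.+1) zeta &
        exact (xi * v + u * zeta)].

(** * The products <u, v, v> along quasi-isomorphisms and in formal algebras *)

Section QuasiIso.
Context {K : fieldType} {A B : cdga K} {f : cd_alg A -> cd_alg B}.
Hypotheses (nz2 : (2 : K) != 0) (qf : quasi_iso f).

Let mf : cdga_morphism f. Proof. by case: qf. Qed.

(** The bounding data in [B] is lifted: [zeta'] up to exact terms, and [xi'] by correcting a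
    primitive of [u * v] by a cocycle. Injectivity on cohomology concludes. *)
Lemma massey_quasi_iso_domain : massey_uvv_vanish B -> massey_uvv_vanish A.
Proof.
case: (qf) => _ fsurj finj PB p m u v cu cv em euv.
have euv' : exact (f u * f v) by rewrite -(morM mf); apply: (mor_exact mf).
have [xi' [zeta' [hxi' dxi' czeta' exi']]] :=
  PB p m _ _ (mor_cocycle mf cu) (mor_cocycle mf cv) em euv'.
have [zeta [czeta ezeta]] := fsurj _ _ czeta'.
have [huv _] := cocycleM cu cv; rewrite addnS in huv.
have [xi0 [dxi0 hxi0]] := exact_hom huv euv.
(* Two primitives of [f u * f v] differ by a cocycle, whose class lifts to [c]. *)
have cdiff : cocycle (p + m) (f xi0 - xi').
  split; first by apply: cd_homB => //; apply: (mor_hom mf).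
  by rewrite cd_dB -(mor_d mf) -dxi0 (morM mf) dxi' subrr.
have [c [[hc dc] ec]] := fsurj _ _ cdiff.
have vv0 : v * v = 0 by apply: (odd_sqr0 nz2 _ cv.1).
have dxi : cd_d A (xi0 - c) = u * v by rewrite cd_dB -dxi0 dc subr0.
have hxi : cd_hom A (p + m) (xi0 - c) by apply: cd_homB.
exists (xi0 - c), zeta; split=> //.
apply: (finj (p + m + m.+1)%N).
  split; last first.
    by rewrite cd_dD (cd_dMr _ cv.2) dxi -mulrA vv0 mulr0 (cd_dMl _ cu) czeta.2
               mulr0 scaler0 addr0.
  apply: cd_homD; first exact: cd_homM hxi cv.1.
  by apply: cd_hom_eq (cd_homM cu.1 czeta.1) _; lia.
apply: exact_of_sub exi'; rewrite (morD mf) !(morM mf) opprD addrACA.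
rewrite -mulrBl -mulrBr; apply: exactD.
  apply: exactMr (mor_cocycle mf cv).2 _.
  rewrite (morB mf); move: ec; rewrite -exactN => ec.
  suff -> : f xi0 - f c - xi' = - (f c - (f xi0 - xi')) by [].
  by rewrite opprB addrAC.
exact: exactMl (mor_cocycle mf cu) ezeta.
Qed.

(** Here [u] and [v] are only cohomologous to images [f u0] and [f v0], so the transported data is
    corrected by primitives [a] and [b] of the differences. *)
Lemma massey_quasi_iso_codomain : massey_uvv_vanish A -> massey_uvv_vanish B.
Proof.
case: (qf) => _ fsurj finj PA p m u v cu cv em euv.
have [u0 [cu0 eu]] := fsurj _ _ cu.
have [v0 [cv0 ev]] := fsurj _ _ cv.
have cfu := mor_cocycle mf cu0; have cfv := mor_cocycle mf cv0.
have vv0 : v * v = 0 by apply: (odd_sqr0 nz2 _ cv.1).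
(* In degree [p = 0] exactness forces [u = f u0], whence the value [a = 0]. *)
have [a [da ha]] : exists a, u - f u0 = cd_d B a /\
    (if p is p'.+1 then cd_hom B p' a else a = 0).
  apply: exact_hom; first exact: cd_homB cu.1 cfu.1.
  by rewrite -exactN opprB.
have [b [db /= hb]] : exists b, v - f v0 = cd_d B b /\ cd_hom B m b.
  apply: (@exact_hom _ _ m.+1); first exact: cd_homB cv.1 cfv.1.
  by rewrite -exactN opprB.
have def_u : u = f u0 + cd_d B a by rewrite -da addrC subrK.
have def_v : v = f v0 + cd_d B b by rewrite -db addrC subrK.
have euv0 : exact (u0 * v0).
  apply: finj (cocycleM cu0 cv0) _; rewrite (morM mf).
  apply: exact_of_sub euv.
  have -> : f u0 * f v0 - u * v = - (cd_d B a * v + f u0 * cd_d B b).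
    by rewrite [in u * v]def_u mulrDl {1}def_v mulrDr opprD addrA opprD addrA subrr
       add0r -opprD addrC.
  apply/exactN; apply: exactD; first by apply: exactMr cv.2 _; apply: exact_d.
  by apply: exactMl cfu _; apply: exact_d.
have [xi [zeta [hxi dxi czeta exi]]] := PA _ _ _ _ cu0 cv0 em euv0.
pose sp : K := (-1) ^+ p.
have spp : sp * sp = 1 by rewrite -expr2 sqrr_sign.
have sm : (-1 : K) ^+ (p + m) = sp.
  by rewrite exprD -[_ ^+ m]signr_odd (negPf em) mulr1.
have cfz := mor_cocycle mf czeta.
(* The differentials of the three terms are [f u0 * f v0], [f u0 * d b] and [d a * v], which add up
   to [u * v]. *)
exists (f xi + sp *: (f u0 * b) + a * v), (f zeta); split=> //.
- apply: cd_homD; [apply: cd_homD|].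
  + exact: (mor_hom mf).
  + by apply: cd_homZ; apply: cd_homM cfu.1 hb.
  + case: (p) ha => [->|p' ha]; first by rewrite mul0r; apply: cd_hom0.
    by apply: cd_hom_eq (cd_homM ha cv.1) _; lia.
- rewrite !cd_dD -(mor_d mf) dxi (morM mf) cd_dZ (cd_dMl _ cfu) scalerA spp scale1r.
  by rewrite (cd_dMr _ cv.2) -mulrDr -def_v -mulrDl -def_u.
have b_comm : b * f v0 = f v0 * b := even_comm em hb cfv.1.
(* The even element [b] commutes with [d b], so [b * d b] is the differential of half a square. *)
have dbb : cd_d B (2^-1 *: (b * b)) = b * cd_d B b.
  have hdb := cd_d_hom hb.
  rewrite cd_dZ (cd_leibniz b hb) -(even_comm em hb hdb).
  rewrite -signr_odd (negPf em) scale1r -mulr2n -scaler_nat scalerA.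
  by rewrite mulVf // scale1r.
(* Integration by parts: the term [f u0 * f v0 * b] will cancel the one coming from
   [sp *: (f u0 * b) * v], since [b] commutes with [f v0]. *)
have xib : f xi * cd_d B b = sp *: (cd_d B (f xi * b) - f u0 * f v0 * b).
  rewrite (cd_leibniz b (mor_hom mf hxi)) sm -(mor_d mf) dxi (morM mf).
  by rewrite addrAC subrr add0r scalerA spp scale1r.
have -> : (f xi + sp *: (f u0 * b) + a * v) * v + u * f zeta =
   f (xi * v0 + u0 * zeta) + cd_d B a * f zeta + sp *: cd_d B (f xi * b)
     + sp *: (f u0 * cd_d B (2^-1 *: (b * b))).
  rewrite !mulrDl -(mulrA a) vv0 mulr0 addr0 [in f xi * v]def_v mulrDr xib.
  rewrite [in u * _]def_u [(_ + cd_d B a) * _]mulrDl (morD mf) !(morM mf) dbb.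
  rewrite -scalerAl [in _ * v]def_v -!mulrA mulrDr b_comm mulrDr !scalerDr scalerN.
  rewrite -!addrA; congr (_ + _).
  by rewrite addKr addrA [LHS]addrC -addrA.
apply: exactD; last by apply: exactZ; apply: exactMl cfu _; apply: exact_d.
apply: exactD; last by apply: exactZ; apply: exact_d.
apply: exactD; first exact: (mor_exact mf).
by apply: exactMr cfz.2 _; apply: exact_d.
Qed.

End QuasiIso.

Lemma massey_d0 (K : fieldType) (A : cdga K) :
  (forall x, cd_d A x = 0) -> massey_uvv_vanish A.
Proof.
move=> d0 p m u v _ _ _ [y ->]; exists 0, 0; split.
- exact: cd_hom0.
- by rewrite !d0.
- exact: cocycle0.
- by rewrite mul0r mulr0 addr0; apply: exact0.
Qed.

(** Induction along the zigzag, from its end with zero differential; the direction of each arrow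
    decides which transfer applies. *)
Lemma massey_formal (K : fieldType) (A : cdga K) :
  (2 : K) != 0 -> formal A -> massey_uvv_vanish A.
Proof.
move=> nz2 [C [d0 zz]]; move/massey_d0: d0.
elim: zz => // {A C} A B C f qf _ IH /IH.
  exact: massey_quasi_iso_domain nz2 qf.
exact: massey_quasi_iso_codomain nz2 qf.
Qed.

(** * The extension by [theta] and its products <u, v, v> *)

Section KSExtension.
Context {K : fieldType} {M N : cdga K} {omega : cd_alg M} {m : nat}.
Context {i : cd_alg M -> cd_alg N} {theta : cd_alg N}.
Hypothesis ks : is_KS_extension omega m i theta.

Let mi : cdga_morphism i. Proof. by case: ks. Qed.
Let htheta : cd_hom N m theta. Proof. by case: ks. Qed.
Let dtheta : cd_d N theta = i omega. Proof. by case: ks. Qed.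

Lemma ks_inj a b a' b' :
  i a + i b * theta = i a' + i b' * theta -> a = a' /\ b = b'.
Proof.
case: ks => _ _ _ /bij_inj inj e.
by have [] : (a, b) = (a', b') by apply: inj.
Qed.

Lemma ks_surj x : exists a b, x = i a + i b * theta.
Proof. by case: ks => _ _ _ [g _ gK]; exists (g x).1, (g x).2. Qed.

Lemma ks_hom n x : cd_hom N (n + m) x ->
  exists a b, [/\ cd_hom M (n + m) a, cd_hom M n b & x = i a + i b * theta].
Proof.
move=> hx; have [a [b def_x]] := ks_surj x.
have [na [ca [hca def_a]]] := cd_hom_components a.
have [nb [cb [hcb def_b]]] := cd_hom_components b.
exists (ca (n + m)%N), (cb n); split=> //.
pose L := (n + na + nb).+1.
(* [e j] is the part of [x] in degree [j]. The guard matters: for [j < m] the subtraction [j - m]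
   would truncate to 0. *)
pose e j := i (ca j) + (if (m <= j)%N then i (cb (j - m)%N) * theta else 0).
have he j : cd_hom N j (e j).
  apply: cd_homD; first exact: (mor_hom mi).
  case: leqP => le_mj; last exact: cd_hom0.
  by apply: cd_hom_eq (cd_homM (mor_hom mi (hcb _)) htheta) _; rewrite subnK.
rewrite (@cd_hom_component _ _ _ x (m + L) e hx he); last by rewrite /L; lia.
  by rewrite /e leq_addl addnK.
rewrite big_split /= -(mor_sum mi) -def_a; last by rewrite /L; lia.
rewrite big_split_ord /= [X in _ + (X + _)]big1 => [|j _]; last by rewrite leqNgt ltn_ord.
rewrite add0r def_x (def_b L); last by rewrite /L; lia.
rewrite (mor_sum mi) mulr_suml; congr (_ + _); apply: eq_bigr => j _.
by rewrite leq_addr addKn.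
Qed.

Lemma ks_d n a b : cd_hom M n b ->
  cd_d N (i a + i b * theta) =
    i (cd_d M a + (-1) ^+ n *: (b * omega)) + i (cd_d M b) * theta.
Proof.
move=> hb; rewrite cd_dD (cd_leibniz _ (mor_hom mi hb)) dtheta.
by rewrite (morD mi) (morZ mi) (morM mi) !(mor_d mi) addrA addrAC.
Qed.

(** The sign before [b * omega] varies with the component of [b], so the part in [M] is left
    unspecified; only the coefficient of [theta] is tracked. *)
Lemma ks_d_theta b : exists a, cd_d N (i b * theta) = i a + i (cd_d M b) * theta.
Proof.
move: b; apply: cd_hom_ind => [n b hb|b c [a1 e1] [a2 e2]].
  exists ((-1) ^+ n *: (b * omega)).
  by have := ks_d 0 hb; rewrite (mor0 mi) add0r cd_d0 add0r.
exists (a1 + a2); rewrite (morD mi b) mulrDl !cd_dD e1 e2 !(morD mi) mulrDl.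
by rewrite addrACA.
Qed.

(** By uniqueness of coefficients, taking the coefficient of [theta] commutes with [d]. *)
Lemma ks_exact a b : exact (i a + i b * theta) -> exact b.
Proof.
move=> [x]; have [g [h ->]] := ks_surj x; have [e dh] := ks_d_theta h.
by rewrite cd_dD dh -(mor_d mi) addrA -(morD mi) => /ks_inj[_ ->]; apply: exact_d.
Qed.

End KSExtension.

(** The vanishing is applied to [a w] and [v]. With [q] and [c] the coefficients of [theta] in [xi]
    and [zeta], it makes [a w c - q v] exact. Injectivity of [omega] makes [a c] exact and [b]
    cohomologous to [q] up to sign. *)
Lemma massey_KS_extension (K : fieldType) (M N : cdga K) (omega : cd_alg M)
    (t s : nat) (i : cd_alg M -> cd_alg N) (theta : cd_alg N) :
  is_KS_extension omega (t + t.+1) i theta -> massey_uvv_vanish N -> ~~ odd t ->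
  cocycle (t.+1 + t.+1) omega ->
  (forall a : cd_alg M, cocycle s a -> exact (omega * a) -> exact a) ->
  forall a b w v : cd_alg M, cocycle s a -> cocycle s b -> cocycle t.+1 w -> cocycle t.+1 v ->
  exact (omega * b - a * w * v) -> exact (b * v).
Proof.
move=> ks PN et comega inj a b w v ca cb cw cv eb.
have [mi htheta dtheta _] := ks.
have omegaC n x : cd_hom M n x -> omega * x = x * omega.
  by apply: even_comm comega.1; rewrite addnn odd_double.
have euv : exact (i (a * w) * i v).
  rewrite -(morM mi); apply: exact_of_sub (_ : exact (i (omega * b))).
    by rewrite -(morB mi) -exactN -(morN mi) opprB; apply: (mor_exact mi).
  exists ((-1) ^+ s *: (i b * theta)).
  rewrite cd_dZ (cd_dMl _ (mor_cocycle mi cb)) scalerA -expr2 sqrr_sign scale1r.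
  by rewrite dtheta -(morM mi) (omegaC _ _ cb.1).
have [xi [zeta [hxi dxi czeta exi]]] :=
  PN _ _ _ _ (mor_cocycle mi (cocycleM ca cw)) (mor_cocycle mi cv) et euv.
(* Regrouping the degree as [s] plus that of [theta] puts [q] in degree [s]; in the same way [c] has
   degree 0. *)
have {}hxi : cd_hom N (s + (t + t.+1)) xi by apply: cd_hom_eq hxi _; lia.
have [p [q [hp hq def_xi]]] := ks_hom ks hxi.
have [mu [c [hmu hc def_zeta]]] := ks_hom ks (czeta.1 : cd_hom N (0 + (t + t.+1)) zeta).
have [dp dq] : cd_d M p + (-1) ^+ s *: (q * omega) = a * w * v /\ cd_d M q = 0.
  apply: (ks_inj ks); rewrite -(ks_d ks _ hq) -def_xi dxi (mor0 mi) mul0r addr0.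
  by rewrite -(morM mi).
have [dmu dc] : cd_d M mu + (-1) ^+ 0 *: (c * omega) = 0 /\ cd_d M c = 0.
  apply: (ks_inj ks); rewrite -(ks_d ks _ hc) -def_zeta czeta.2.
  by rewrite (mor0 mi) mul0r addr0.
have thetaC : theta * i v = - (i v * theta).
  apply: odd_comm htheta (mor_hom mi cv.1) => //=.
  by rewrite addnS /= addnn odd_double.
(* This is the coefficient of [theta] in [xi * i v + i (a * w) * zeta]; the minus sign comes from
   moving [theta] past the odd [v]. *)
have eq : exact (a * w * c - q * v).
  apply: (ks_exact ks (a := p * v + a * w * mu)).
  have -> : i (p * v + a * w * mu) + i (a * w * c - q * v) * theta =
    xi * i v + i (a * w) * zeta; last by [].
  rewrite def_xi def_zeta (morB mi) (morD mi) !(morM mi) mulrBl mulrDl mulrDr.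
  rewrite -[i q * theta * _]mulrA thetaC mulrN !mulrA.
  by rewrite [_ - i q * _ * _]addrC addrACA.
have eomegac : exact (omega * c).
  rewrite (omegaC _ _ hc); exists (- mu).
  by rewrite cd_dN; apply/eqP; rewrite -addr_eq0 addrC -[c * omega]scale1r dmu.
have cc : cocycle 0 c by split.
have eac : exact (a * c).
  apply: inj; first by apply: cocycle_eq (cocycleM ca cc) _; rewrite addn0.
  by rewrite mulrA (omegaC _ _ ca.1) -mulrA; apply: exactMl ca _.
have eawc : exact (a * w * c).
  by rewrite -mulrA -(even_comm _ hc cw.1) // mulrA; apply: exactMr cw.2 _.
have {}eq : exact (q * v) by move/(exactDl _ eawc).1: eq => /exactN.
have cq : cocycle s q by split.
(* Both [omega * b] and [q * omega] with its sign are cohomologous to [a * w * v]. *)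
have : exact (b - (-1) ^+ s *: q).
  apply: inj; first by apply: cocycleD cb (cocycleN (cocycleZ _ cq)).
  rewrite mulrBr -scalerAr (omegaC _ _ hq).
  apply: exact_of_sub (_ : exact (omega * b - a * w * v)) => //.
  by rewrite -dp opprB addrC addrA addrNK addrK; apply: exact_d.
move/(exactMr cv.2); rewrite mulrBl => /exact_of_sub; apply.
by rewrite -scalerAl; apply: exactZ.
Qed.

(** * Commuting operators of square zero on H^s *)

Section Nilpotence.
Context {K : fieldType} {M : cdga K} {omega : cd_alg M} {r s : nat}.
Hypotheses (odd_r : odd r) (comega : cocycle (2 * r) omega).
Hypothesis surj : forall b : cd_alg M, cocycle (s + 2 * r) b ->
  exists a : cd_alg M, cocycle s a /\ exact (omega * a - b).
Hypothesis massey : forall a b w v : cd_alg M,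
  cocycle s a -> cocycle s b -> cocycle r w -> cocycle r v ->
  exact (omega * b - a * w * v) -> exact (b * v).

(** These are the cross terms of [(b + b') * (v + v')], to which [massey] applies by linearity. *)
Lemma massey_polarized a b b' w v v' :
  cocycle s a -> cocycle s b -> cocycle s b' ->
  cocycle r w -> cocycle r v -> cocycle r v' ->
  exact (omega * b - a * w * v) -> exact (omega * b' - a * w * v') ->
  exact (b * v' + b' * v).
Proof.
move=> ca cb cb' cw cv cv' eb eb'.
have ebv : exact (b * v) by apply: massey eb.
have ebv' : exact (b' * v') by apply: massey eb'.
have : exact ((b + b') * (v + v')).
  apply: massey ca (cocycleD cb cb') cw (cocycleD cv cv') _.
  by rewrite !mulrDr opprD addrACA; apply: exactD.
by rewrite mulrDl !mulrDr -addrA => /(exactDl _ ebv); rewrite addrA => /(exactDr _ ebv').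
Qed.

(* Vanishing of A_(z,w) a implies that of A_(z,w) (A_(x,y) a), for b = A_(x,y) a. *)
Lemma massey_comm a b x y z w :
  cocycle s a -> cocycle s b ->
  cocycle r x -> cocycle r y -> cocycle r z -> cocycle r w ->
  exact (omega * b - a * x * y) -> exact (a * z * w) -> exact (b * z * w).
Proof.
move=> ca cb cx cy cz cw eb eaw.
have anti (u v : cd_alg M) : cocycle r u -> cocycle r v -> u * v = - (v * u).
  by move=> cu cv; apply: odd_comm cu.1 cv.1.
(* [c] represents A_(x,z) a; as [x] and [z] anticommute, [- c] represents A_(z,x) a. *)
have [c [cc ec]] : exists c, cocycle s c /\ exact (omega * c - a * x * z).
  by apply: surj; apply: cocycle_eq (cocycleM (cocycleM ca cx) cz) _; lia.
have e1 : exact (b * z + c * y) by apply: massey_polarized eb ec.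
(* Polarising between [x] and [w], with 0 representing A_(z,w) a, makes [c w] exact. Then [b z w] is
   cohomologous to [- c y w = c w y], which is exact. *)
have e2 : exact (- c * w + 0 * x).
  apply: (@massey_polarized a _ _ z x w) => //.
  - exact: cocycleN.
  - exact: cocycle0.
  - by rewrite -mulrA (anti z x) // !mulrN opprK mulrA -exactN opprD opprK.
  - by rewrite mulr0 sub0r exactN.
move/(exactMr cw.2): e1; rewrite mulrDl -[c * y * w]mulrA (anti y w) // mulrN mulrA.
move/exact_of_sub; apply; apply: exactMr cy.2 _.
by move: e2; rewrite mul0r addr0 mulNr exactN.
Qed.

(** With A_j = A_(x_j,y_j), induction on [n] shows that a class killed by all A_j with [n <= j] is
    zero. For [n = 0], the sum of the A_j is the identity. In the step, A_n a is killed by A_n, of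
    square zero, and by the later A_l, by commutation; hence it vanishes, and [a] is killed by A_n
    too. *)
Lemma massey_nilpotent k (x y : 'I_k -> cd_alg M) :
  (forall j, cocycle r (x j)) -> (forall j, cocycle r (y j)) ->
  exact (omega - \sum_(j < k) x j * y j) ->
  (forall a : cd_alg M, cocycle s a -> exact (omega * a) -> exact a) ->
  forall a : cd_alg M, cocycle s a -> exact a.
Proof.
move=> cx cy eomega inj.
suff vanish n (a : cd_alg M) : cocycle s a ->
    (forall j : 'I_k, (n <= j)%N -> exact (a * x j * y j)) -> exact a.
  by move=> a ca; apply: (vanish k) => // j; rewrite leqNgt ltn_ord.
elim: n a => [|n IHn] a ca ea.
  apply: inj => //; rewrite (even_comm _ comega.1 ca.1) ?mul2n ?odd_double //.
  apply: exact_of_sub (_ : exact (a * \sum_(j < k) x j * y j)).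
    by rewrite -mulrBr; apply: exactMl ca _.
  by rewrite mulr_sumr; apply: exact_sum => j; rewrite mulrA; apply: ea.
apply: (IHn) => // j; rewrite leq_eqVlt => /predU1P[def_n|/ea //].
have [b [cb eb]] : exists b, cocycle s b /\ exact (omega * b - a * x j * y j).
  by apply: surj; apply: cocycle_eq (cocycleM (cocycleM ca (cx j)) (cy j)) _; lia.
apply/exactN; apply: (exactDl _ _).1 (eb).
apply: exactMl comega _; apply: IHn => // l; rewrite leq_eqVlt => /predU1P[def_l|lt_nl].
  have <- : j = l by apply: ord_inj; rewrite -def_n -def_l.
  (* This is A_j^2 = 0: already [b * y j] is exact. *)
  have := massey ca cb (cx j) (cy j) eb; move/(exactMr (cx j).2).
  by rewrite -!mulrA (odd_comm odd_r odd_r (cx j).1 (cy j).1) mulrN exactN.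
by apply: massey_comm eb (ea l lt_nl).
Qed.

End Nilpotence.

Theorem theorem4p2 (K : fieldType) (M : cdga K) (omega : cd_alg M) (r : nat) :
  [pchar K] =i pred0 ->
  sullivan_minimal M ->
  odd r ->
  cocycle (2 * r) omega ->
  (exists (k : nat) (x y : 'I_k -> cd_alg M),
      (forall j, cocycle r (x j)) /\ (forall j, cocycle r (y j)) /\
      exact (omega - \sum_(j < k) x j * y j)) ->
  (exists s : nat,
      [/\ exists a : cd_alg M, cocycle s a /\ ~ exact a,
          forall a : cd_alg M, cocycle s a -> exact (omega * a) -> exact a,
          forall b : cd_alg M, cocycle (s + 2 * r) b ->
                    exists a : cd_alg M, cocycle s a /\ exact (omega * a - b) &
          (r <= s)%N ->
            forall a : cd_alg M, cocycle (s - r) a -> exact (omega * a) -> exact a]) ->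
  forall (N : cdga K) (i : cd_alg M -> cd_alg N) (theta : cd_alg N),
    is_KS_extension omega (2 * r - 1) i theta ->
    ~ formal N.
Proof.
move=> pchar0 _ odd_r comega [k [x [y [cx [cy eomega]]]]].
move=> [s [[a0 [ca0 nea0]] inj surj _]] N i theta ks fN; apply: nea0.
have nz2 : (2 : K) != 0 by have := pchar0 2; rewrite !inE /= => ->.
have PN := massey_formal nz2 fN.
(* Oddness excludes [r = 0]; with [r = t.+1] the degree of [theta] becomes [t + t.+1], free of
   truncated subtraction. *)
case: r odd_r comega surj ks cx cy eomega => // t et comega surj ks cx cy eomega.
apply: (massey_nilpotent et comega surj _ cx cy eomega inj ca0).
have def_m : (2 * t.+1 - 1 = t + t.+1)%N by lia.
rewrite def_m in ks.
by apply: (massey_KS_extension ks PN _ _ inj); rewrite ?addnn -?mul2n.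
Qed.
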